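(* Let $l,r,b,a$ be positive integers, let $R_1=[-l,r]\setminus\{0\}$ and $R_2=[-b,a]\setminus\{0\}$ (integer intervals), and let $R^2=(R_1\times\{0\})\cup(\{0\}\times R_2)\subset\mathbb Z^2$ be the recovery set of the axial product of one-dimensional systems with recovery sets $R_1$ and $R_2$. Then $$\mathsf{cap}(\mathbb Z^2_{R^2})=\frac{t}{t+1},\qquad t=\max\bigl\{\min\{l,r\},\min\{a,b\}\bigr\}.$$ Moreover, a system that attains this value can be obtained from a one-dimensional $R$-recoverable system with $R=\{j:0<|j|\le t\}$: there is an $R$-recoverable system $Y\subseteq Q^{\mathbb Z}$ such that the set $X$ of all $x\in Q^{\mathbb Z^2}$ each of whose rows (if $t=\min\{l,r\}$), respectively each of whose columns (if $t=\min\{a,b\}$), belongs to $Y$ is an $R^2$-recoverable system of rate $t/(t+1)$.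
   Context: Fix a finite alphabet $Q$ of size $q\ge 2$. For $d\in\{1,2\}$ and a finite $R\subset\mathbb Z^d\setminus\{0\}$, an $R$-recoverable system on $\mathbb Z^d$ is a nonempty set $X\subseteq Q^{\mathbb Z^d}$ such that for every $v\in\mathbb Z^d$ there is a function $f_v:Q^{|R|}\to Q$ (which may depend on $v$) with $x_v=f_v(x_{v+R})$ for all $x\in X$, where $x_{v+R}$ is the restriction of $x$ to $v+R=\{v+z:z\in R\}$. Its rate is $\limsup_{n\to\infty}\frac1{n^d}\log_q|\mathcal B_{[n]^d}(X)|$, where $\mathcal B_{[n]^d}(X)$ is the set of restrictions of the words of $X$ to $[n]^d=\{0,\dots,n-1\}^d$. The capacity $\mathsf{cap}(\mathbb Z^d_R)$ is the supremum of the rates over all $R$-recoverable systems $X\subseteq Q^{\mathbb Z^d}$. For $x\in Q^{\mathbb Z^2}$, a row is a sequence $(x_{(i,j)})_{i\in\mathbb Z}$ with $j$ fixed and a column is a sequence $(x_{(i,j)})_{j\in\mathbb Z}$ with $i$ fixed. *)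

(* Defs.v *)
From HB Require Import structures.
From mathcomp Require Import all_boot all_order all_algebra finmap zify.
From mathcomp Require Import all_classical all_reals all_analysis.

Set Implicit Arguments.
Unset Strict Implicit.
Unset Printing Implicit Defensive.

Import Order.TTheory GRing.Theory Num.Theory.

Local Open Scope classical_set_scope.
Local Open Scope ring_scope.

(* Z is [int] and Z^2 is [int * int]; a word of Q^{Z^d} is a function G -> Q
   with G the corresponding group.  The map f_v may depend on v. *)
Definition recoverable_system (Q : finType) (G : zmodType) (R : {fset G})
    (X : set (G -> Q)) : Prop :=
  X !=set0 /\
  forall v : G, exists f : {ffun R -> Q} -> Q,
    forall x, X x -> x v = f [ffun z : R => x (v + val z)].

Definition square_blocks (Q : finType) (X : set (int * int -> Q)) (n : nat) :
    {set {ffun 'I_n * 'I_n -> Q}} :=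
  [set w : {ffun 'I_n * 'I_n -> Q} |
    `[< exists2 x, X x &
          forall p : 'I_n * 'I_n, w p = x ((p.1 : nat)%:Z, (p.2 : nat)%:Z) >]]%SET.

(* The term at n = 0 is 0, since division by 0 gives 0 here; it does not affect
   the limsup. *)
Definition rate (K : realType) (Q : finType) (X : set (int * int -> Q)) :
    \bar K :=
  limn_esup (fun n : nat =>
    ((n%:R ^+ 2)^-1 * (ln #|square_blocks X n|%:R / ln #|Q|%:R))%:E).

Definition capacity (K : realType) (Q : finType) (R : {fset int * int}) :
    \bar K :=
  ereal_sup [set rate K X | X in @recoverable_system Q _ R].

(* [-l, r] \ {0} *)
Definition punctured_itv (l r : nat) : {fset int} :=
  ([fset i%:Z - l%:Z | i in iota 0 (l + r).+1] `\ 0)%fset.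

Definition axial_product (R1 R2 : {fset int}) : {fset int * int} :=
  ([fset (k, 0 : int) | k in R1] `|` [fset (0 : int, k) | k in R2])%fset.

Definition word_row (Q : Type) (x : int * int -> Q) (j : int) : int -> Q :=
  fun i => x (i, j).

Definition word_column (Q : Type) (x : int * int -> Q) (i : int) : int -> Q :=
  fun j => x (i, j).

Lemma in_punctured_itv (l r : nat) (k : int) :
  (k \in punctured_itv l r) = [&& - l%:Z <= k, k <= r%:Z & k != 0].
Proof.
rewrite /punctured_itv in_fsetD1.
have -> : (k \in [fset i%:Z - l%:Z | i in iota 0 (l + r).+1]%fset)
          = (- l%:Z <= k) && (k <= r%:Z).
  apply/imfsetP/idP => [[i]|/andP[h1 h2]].
    by rewrite -[_ \in _]/(i \in iota 0 (l + r).+1) mem_iota => hi ->; lia.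
  exists (absz (k + l%:Z)); last by lia.
  by rewrite -[_ \in _]/((absz (k + l%:Z)) \in iota 0 (l + r).+1) mem_iota; lia.
by case: (k != 0); rewrite /= ?andbT ?andbF.
Qed.

Lemma in_punctured_itv_sym (t : nat) (k : int) :
  (k \in punctured_itv t t) = (0 < `|k|) && (`|k| <= t%:Z).
Proof. by rewrite in_punctured_itv; lia. Qed.

(* Main.v *)
(* Upper bound: along the lattice i + j = 0 mod (t + 1), two points of a common
   row or column differ by at least t + 1, hence an axial dependency between
   them can only point towards the longer side of [-l, r], resp. [-b, a].
   Dependencies inside the lattice are thus acyclic, and the values on the
   lattice, of density 1 / (t + 1), are determined by the other ones.
   Lower bound: identify Q with Z/q and ask that the letters of every row sum to
   zero on each interval [m (t + 1), m (t + 1) + t]; one letter in t + 1 is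
   redundant, and every letter is recovered from those at distance at most t. *)

Require Import Defs.
From HB Require Import structures.
From mathcomp Require Import all_boot all_order all_algebra finmap.
From mathcomp Require Import zify ring.
From mathcomp Require Import all_classical all_reals all_analysis.

Set Implicit Arguments.
Unset Strict Implicit.
Unset Printing Implicit Defensive.

Import Order.TTheory GRing.Theory Num.Theory.

Local Open Scope classical_set_scope.
Local Open Scope ring_scope.

(** * Recoverability as determination, and block counts under acyclic dependencies *)

Lemma recoverable_systemP (Q : finType) (G : zmodType) (R : {fset G})
    (X : set (G -> Q)) :
  recoverable_system R X <->
  X !=set0 /\
  forall (v : G) (x x' : G -> Q), X x -> X x' ->
    (forall z, z \in R -> x (v + z) = x' (v + z)) -> x v = x' v.
Proof.
split=> -[X0 recX]; split=> // v.
  move=> x x' Xx Xx' eqR; have [f fX] := recX v.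
  rewrite (fX _ Xx) (fX _ Xx'); congr f.
  by apply/ffunP => z; rewrite !ffunE eqR ?fsvalP.
have [x0 _] := X0.
pose ok (g : {ffun R -> Q}) (c : Q) :=
  exists2 x, X x & g = [ffun z : R => x (v + val z)] /\ c = x v.
(* Patterns that no word of [X] shows around [v] get the default letter [x0 v]. *)
exists (fun g => xget (x0 v) [set c | ok g c]) => x Xx.
have okx : ok [ffun z : R => x (v + val z)] (x v) by exists x.
case: xgetP => [c _ /= [y Xy [eqg ->]]|/(_ (x v))//].
apply: recX => // z zR.
by have /ffunP/(_ [` zR]%fset) := eqg; rewrite !ffunE.
Qed.

Definition grid n (p : 'I_n * 'I_n) : int * int :=
  ((p.1 : nat)%:Z, (p.2 : nat)%:Z).

Lemma square_blocksP (Q : finType) (X : set (int * int -> Q)) n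
    (w : {ffun 'I_n * 'I_n -> Q}) :
  reflect (exists2 x, X x & forall p, w p = x (grid p))
          (w \in square_blocks X n).
Proof. by rewrite /square_blocks inE; exact: asboolP. Qed.

(* The values on F are recovered one after the other, by increasing rank, from
   the values outside F. *)
Lemma card_square_blocks_acyclic (Q : finType) (R : {fset int * int})
    (X : set (int * int -> Q)) n (F : {set 'I_n * 'I_n})
    (rk : 'I_n * 'I_n -> nat) :
  recoverable_system R X ->
  (forall p z, p \in F -> z \in R ->
     exists2 p', grid p' = grid p + z & p' \in F -> (rk p' < rk p)%N) ->
  (#|square_blocks X n| <= #|Q| ^ (n * n - #|F|))%N.
Proof.
move=> /recoverable_systemP[_ recX] acyc.
have -> : (n * n - #|F| = #|{: {p | p \in ~: F}}|)%N.
  rewrite card_sig; have := cardsC F; rewrite card_prod card_ord => <-.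
  by rewrite addKn; apply: eq_card => p; rewrite !inE.
rewrite -card_ffun.
pose restr (w : {ffun 'I_n * 'I_n -> Q}) :=
  [ffun p : {p | p \in ~: F} => w (val p)].
apply: (@leq_card_in _ _ restr) => w w'.
move=> /square_blocksP[x Xx wx] /square_blocksP[x' Xx' wx'] /ffunP eqw.
suff eqr k p : (rk p < k)%N -> w p = w' p by apply/ffunP => p; exact: eqr (ltnSn _).
elim: k p => // k IH p; rewrite ltnS => rkp.
have [pF|pNF] := boolP (p \in F); last first.
  have pC : p \in ~: F by rewrite inE.
  by have := eqw (exist _ p pC); rewrite !ffunE.
rewrite wx wx'; apply: recX => // z zR.
have [p' <- ltp] := acyc p z pF zR; rewrite -wx -wx'.
have [p'F|p'NF] := boolP (p' \in F); first by apply: IH; exact: leq_trans (ltp p'F) _.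
have pC : p' \in ~: F by rewrite inE.
by have := eqw (exist _ p' pC); rewrite !ffunE.
Qed.

(** * The diagonal lattice and the upper bound on block counts *)

Lemma mem_axial_product (R1 R2 : {fset int}) (z : int * int) :
  (z \in axial_product R1 R2) =
  ((z.1 \in R1) && (z.2 == 0)) || ((z.1 == 0) && (z.2 \in R2)).
Proof.
case: z => u v; rewrite /axial_product in_fsetU /=; congr (_ || _).
  apply/imfsetP/andP => [[k kR [-> ->]]|[uR /eqP->]]; first by rewrite kR.
  by exists u.
apply/imfsetP/andP => [[k kR [-> ->]]|[/eqP-> vR]]; first by rewrite kR.
by exists v.
Qed.

Lemma exists_grid n (u v : int) :
  0 <= u < n%:Z -> 0 <= v < n%:Z -> exists p : 'I_n * 'I_n, grid p = (u, v).
Proof.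
move=> hu hv; have un : (`|u| < n)%N by lia.
have vn : (`|v| < n)%N by lia.
by exists (Ordinal un, Ordinal vn); rewrite /grid /=; congr (_, _); lia.
Qed.

(** The margin [M] keeps the recovery sets of the lattice points inside the square, once [M] is at
    least every shift. *)
Definition diagonal_set (n M t : nat) : {set 'I_n * 'I_n} :=
  [set p : 'I_n * 'I_n | [&& (M <= p.1)%N, (p.1 + M < n)%N, (M <= p.2)%N,
    (p.2 + M < n)%N & (t.+1 %| p.1 + p.2)%N]]%SET.

(** Each of the [n - M.*2] rows of the inner square meets the lattice once in every [t.+1]
    consecutive positions. As [t.+1] divides [M], the margin does not change the residue. *)
Lemma card_diagonal_set n M t : (t.+1 %| M)%N ->
  ((n - M.*2) * ((n - M.*2) %/ t.+1) <= #|diagonal_set n M t|)%N.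
Proof.
move=> /dvdnP[m ->]; set M' := (m * t.+1)%N.
set h := (n - M'.*2)%N; set k := (h %/ t.+1)%N.
have n0 (j : 'I_h) : (0 < n)%N by have := ltn_ord j; rewrite /h; lia.
have hk : (k * t.+1 <= h)%N by exact: leq_divM.
have ltx (j : 'I_h) (i : 'I_k) :
    (M' + (i * t.+1 + j * t %% t.+1) + M' < n)%N.
  have := ltn_ord j; have ik := ltn_ord i.
  have jt : (j * t %% t.+1 < t.+1)%N by rewrite ltn_mod.
  have : (i.+1 * t.+1 <= k * t.+1)%N by rewrite leq_mul2r ik orbT.
  by rewrite mulSn; rewrite /h in hk *; lia.
have lty (j : 'I_h) : (M' + j + M' < n)%N by have := ltn_ord j; rewrite /h; lia.
have ltx' j i := leq_ltn_trans (leq_addr M' _) (ltx j i).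
have lty' j := leq_ltn_trans (leq_addr M' _) (lty j).
(* Row [j] needs abscissas congruent to [- j], and [j * t] is such a residue modulo [t.+1]. *)
pose f (p : 'I_h * 'I_k) := (Ordinal (ltx' p.1 p.2), Ordinal (lty' p.1)).
have f_inj : injective f.
  move=> [j i] [j' i'] [] /= + /addnI /val_inj eqj; rewrite {}eqj.
  by move=> /addnI/addIn/eqP; rewrite eqn_pmul2r // => /eqP/val_inj ->.
rewrite -[h in (h * _)%N]card_ord -[k in (_ * k)%N]card_ord -card_prod.
rewrite -cardsT -(card_imset _ f_inj); apply: subset_leq_card.
apply/fintype.subsetP => _ /imsetP[[j i] _ ->]; rewrite inE /= ltx lty !leq_addr /=.
have -> : (M' + (i * t.+1 + j * t %% t.+1) + (M' + j) =
          (m * 2 + i) * t.+1 + (j * t %% t.+1 + j))%N by rewrite /M'; lia.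
rewrite dvdn_addr ?dvdn_mull // /dvdn modnDml -mulnSr modnMl //.
Qed.

Lemma card_square_blocks_le (Q : finType) (l r b a n : nat)
    (X : set (int * int -> Q)) :
  let t := maxn (minn l r) (minn a b) in
  let M := (t.+1 * (l + r + b + a))%N in
  (0 < #|Q|)%N ->
  recoverable_system (axial_product (punctured_itv l r) (punctured_itv b a)) X ->
  (#|square_blocks X n| <=
     #|Q| ^ (n * n - (n - M.*2) * ((n - M.*2) %/ t.+1)))%N.
Proof.
move=> t M Q0 recX.
apply: (@leq_trans (#|Q| ^ (n * n - #|diagonal_set n M t|))); last first.
  by rewrite leq_pexp2l // leq_sub2l // card_diagonal_set // /M dvdn_mulr.
(* The distance to the border on the longer side, the only direction in which a shift can exceed
   [t]. *)
pose side (u v i : nat) := if (u <= v)%N then (n - i)%N else i.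
apply: (card_square_blocks_acyclic
  (rk := fun p => (side l r p.1 + side b a p.2)%N) recX).
move=> [i j] [u v]; rewrite inE /= => /and5P[Mi iM Mj jM dvd].
rewrite mem_axial_product /= !in_punctured_itv => hR.
have hM : (l + r + b + a <= M)%N by rewrite leq_pmull.
have [||[i' j'] [ei ej]] := @exists_grid n (i%:Z + u) (j%:Z + v); try lia.
exists (i', j'); first by rewrite /grid /= ei ej.
rewrite inE /= => /and5P[_ _ _ _ dvd'].
have lt_t (e : int) : (t.+1%:Z %| e)%Z -> e != 0 -> (t < `|e|)%N.
  by rewrite dvdzE => dvd_e e0; apply: dvdn_leq dvd_e; rewrite absz_gt0.
(* The coordinate sums of two lattice points differ by a multiple of [t.+1]. As [(u, v)] has exactly
   one nonzero coordinate, that coordinate exceeds [t] in absolute value. *)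
have := lt_t (i'%:Z + j'%:Z - (i%:Z + j%:Z)).
rewrite rpredB ?dvdzE //= => /(_ isT).
have := leq_maxl (minn l r) (minn a b); have := leq_maxr (minn l r) (minn a b).
rewrite -/t /side; clearbody M; clearbody t.
by case: ifP => ?; case: ifP => ?; lia.
Qed.

(** * From block counts to rates *)

Lemma near_le_limn_esup (K : realType) (u : (\bar K)^nat) (c : \bar K) :
  (\forall n \near \oo, (c <= u n)%E) -> (c <= limn_esup u)%E.
Proof.
move=> cu; rewrite /limn_esup limf_esupE; apply: le_ereal_inf_tmp => _ [V Voo <-].
have [n [Vn cun]] := @filter_ex _ _ _ _ (filterI Voo cu).
by apply: le_ereal_sup_tmp; exists (u n) => //; exists n.
Qed.

Lemma near_limn_esup_le (K : realType) (u : (\bar K)^nat) (c : \bar K) :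
  (\forall n \near \oo, (u n <= c)%E) -> (limn_esup u <= c)%E.
Proof.
move=> uc; rewrite /limn_esup limf_esupE; apply: ge_ereal_inf.
exists (ereal_sup [set u n | n in [set n | (u n <= c)%E]]).
  by exists [set n | (u n <= c)%E].
by apply: ge_ereal_sup => _ [n unc <-].
Qed.

Lemma rate_le_capacity (K : realType) (Q : finType) (R : {fset int * int})
    (X : set (int * int -> Q)) :
  recoverable_system R X -> (rate K X <= capacity K Q R)%E.
Proof. by move=> recX; apply: le_ereal_sup_tmp; exists (rate K X) => //; exists X. Qed.

Lemma square_blocks_gt0 (Q : finType) (X : set (int * int -> Q)) n :
  X !=set0 -> (0 < #|square_blocks X n|)%N.
Proof.
move=> [x Xx]; apply/card_gt0P; exists [ffun p => x (grid p)].
by apply/square_blocksP; exists x => // p; rewrite ffunE.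
Qed.

(** The exponent exceeds [n^2 t / (t + 1)] by a term linear in [n] only, which vanishes after
    division by [n^2]. *)
Lemma rate_le (K : realType) (Q : finType) (X : set (int * int -> Q)) (t M : nat) :
  (1 < #|Q|)%N -> X !=set0 ->
  (forall n, (#|square_blocks X n| <=
     #|Q| ^ (n * n - (n - M) * ((n - M) %/ t.+1)))%N) ->
  (rate K X <= (t%:R / (t%:R + 1))%:E)%E.
Proof.
move=> Q1 X0 cardX; apply/lee_addgt0Pr => e e0.
have lnQ : 0 < ln #|Q|%:R :> K by rewrite ln_gt0 // ltr1n.
(* The coefficient of the linear error term; beyond the threshold [D / e] it is at most [e * n]. *)
pose D : K := (M + t)%:R *+ 2.
have D0 : 0 <= D by rewrite mulrn_wge0.
apply: near_limn_esup_le; exists (Num.trunc (D / e)).+1 => // n /= nD.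
have n0 : (0 < n)%N by exact: leq_trans nD.
have n0K : 0 < n%:R :> K by rewrite ltr0n.
have Dn : D <= e * n%:R.
  rewrite mulrC -ler_pdivrMr //; apply: le_trans (ltW (truncnS_gt _)) _.
  by rewrite ler_nat.
rewrite -EFinD lee_fin mulrC ler_pdivrMr ?exprn_gt0 // ler_pdivrMr //.
have {}cardX := cardX n; set m := (n * n - _)%N in cardX.
(* With [N = M + t], rounding loses at most [t], so the subtracted product times [t.+1] is at least
   [(n - N)^2], which is at least [n^2 - 2 N n], even for [n <= N] under truncated subtraction. *)
have mle : (m * t.+1 <= n * n * t + (M + t) * 2 * n)%N.
  have := divn_eq (n - M) t.+1; have := ltn_pmod (n - M) (ltn0Sn t).
  rewrite /m mulnBl -mulnA; set k := (_ %/ _)%N; set s := (n - M)%N.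
  move=> ? ?; have sk : (n - (M + t) <= k * t.+1)%N by lia.
  have : ((n - (M + t)) * (n - (M + t)) <= s * (k * t.+1))%N.
    by rewrite leq_mul // /s; lia.
  have : (n * n <= (M + t) * 2 * n + (n - (M + t)) * (n - (M + t)))%N.
    have [nN|/ltnW/subnKC] := leqP n (M + t).
      by have := leq_mul nN (leqnn n); lia.
    move: (M + t)%N => N; move: (n - N)%N => d <-.
    by rewrite !mulnDl !mulnDr; lia.
  by rewrite mulnS; lia.
apply: (@le_trans _ _ (m%:R * ln #|Q|%:R)).
  rewrite mulr_natl -lnXn ?ltr0n ?(ltnW Q1) // -natrX.
  rewrite ler_ln ?posrE ?ltr0n ?square_blocks_gt0 //; last first.
    by rewrite expn_gt0 (ltnW Q1).
  by rewrite ler_nat.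
rewrite ler_pM2r //.
have t0 : 0 < t%:R + 1 :> K by rewrite ltr_wpDl.
rewrite -(ler_pM2r t0).
have -> : (t%:R / (t%:R + 1) + e) * n%:R ^+ 2 * (t%:R + 1) =
   t%:R * n%:R ^+ 2 + e * n%:R * n%:R * (t%:R + 1) :> K.
  by field; rewrite lt0r_neq0.
move: mle; rewrite -(ler_nat K) !natrM natrD -natr1 !natrM => /le_trans; apply.
rewrite expr2 [t%:R * _]mulrC lerD2l.
apply: (@le_trans _ _ (e * n%:R * n%:R)); last first.
  by rewrite ler_peMr ?lerDr // !mulr_ge0 // ltW.
by rewrite ler_pM2r // mulr_natr.
Qed.

(** Rounding down in [n %/ t.+1] only helps here: every [n >= 1] already gives the ratio, with no
    error term. *)
Lemma le_rate (K : realType) (Q : finType) (X : set (int * int -> Q)) (t : nat) :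
  (1 < #|Q|)%N ->
  (forall n, (#|Q| ^ (n * (n - n %/ t.+1)) <= #|square_blocks X n|)%N) ->
  ((t%:R / (t%:R + 1))%:E <= rate K X)%E.
Proof.
move=> Q1 cardX.
have lnQ : 0 < ln #|Q|%:R :> K by rewrite ln_gt0 // ltr1n.
apply: near_le_limn_esup; exists 1%N => // n /= n0.
have n0K : 0 < n%:R :> K by rewrite ltr0n.
rewrite lee_fin [leRHS]mulrC ler_pdivlMr ?exprn_gt0 // ler_pdivlMr //.
have {}cardX := cardX n; set m := (n * _)%N in cardX.
have mge : (n * n * t <= m * t.+1)%N.
  by rewrite /m -!mulnA leq_mul2l mulnBl; have := leq_divM n t.+1; lia.
apply: (@le_trans _ _ (m%:R * ln #|Q|%:R)); last first.
  rewrite mulr_natl -lnXn ?ltr0n ?(ltnW Q1) // -natrX.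
  have qm : (0 < #|Q| ^ m)%N by rewrite expn_gt0 (ltnW Q1).
  rewrite ler_ln ?posrE ?ltr0n ?ler_nat //; exact: leq_trans cardX.
rewrite ler_pM2r //.
have t0 : 0 < t%:R + 1 :> K by rewrite ltr_wpDl.
rewrite mulrAC ler_pdivrMr //.
by move: mge; rewrite -(ler_nat K) !natrM -natr1 expr2 [t%:R * _]mulrC.
Qed.

(** * The one-dimensional system of zero block sums *)

Definition block_sum_zero (Q : Type) (V : zmodType) (phi : Q -> V) (t : nat) :
    set (int -> Q) :=
  [set y | forall m : int, \sum_(k < t.+1) phi (y (m * t.+1%:Z + k%:Z)) = 0].

(** The blocks partition the integers, so the last letter of each can be corrected independently of
    the others. *)
Lemma block_sum_zero_completion (Q : Type) (V : zmodType) (phi : Q -> V)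
    (psi : V -> Q) (t : nat) (y : int -> Q) : cancel psi phi ->
  exists2 y', block_sum_zero phi t y' &
    forall i : int, ~~ (t.+1%:Z %| i + 1)%Z -> y' i = y i.
Proof.
move=> psiK.
pose last i := psi (- \sum_(k < t) phi (y (i - t%:Z + k%:Z))).
exists (fun i => if (t.+1%:Z %| i + 1)%Z then last i else y i); last first.
  by move=> i /negbTE->.
move=> m; rewrite big_ord_recr /=.
have -> : m * t.+1%:Z + t%:Z + 1 = (m + 1) * t.+1%:Z by lia.
rewrite dvdz_mull // /last psiK addrK.
apply/eqP; rewrite subr_eq0; apply/eqP; apply: eq_bigr => k _.
rewrite ifN; last first.
  rewrite -addrA rpredDl ?dvdz_mull //.
  by rewrite dvdzE /= addn1 gtnNdvd // ltnS ltn_ord.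
by congr (phi (y _)); lia.
Qed.

(** The block of [v] lies within distance [t] of [v]. Two words that agree on the rest of it have
    the same block sum, hence the same [phi] value at [v]. *)
Lemma block_sum_zero_recoverable (Q : finType) (V : zmodType) (phi : Q -> V)
    (psi : V -> Q) (t : nat) : cancel psi phi -> injective phi ->
  recoverable_system (punctured_itv t t) (block_sum_zero phi t).
Proof.
move=> psiK phi_inj; apply/recoverable_systemP; split.
  by have [y Yy _] := block_sum_zero_completion t (fun=> psi 0) psiK; exists y.
move=> v y y' Yy Yy' eqy; apply: phi_inj.
have v0 := modz_ge0 v (isT : t.+1%:Z != 0).
have vt := ltz_pmod v (isT : 0 < t.+1%:Z).
have kP : (absz (v %% t.+1%:Z)%Z < t.+1)%N by lia.
pose k0 := Ordinal kP; pose m := (v %/ t.+1%:Z)%Z.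
have vE : v = m * t.+1%:Z + k0%:Z.
  by rewrite {1}(divz_eq v t.+1%:Z) /=; lia.
have := etrans (Yy m) (esym (Yy' m)).
rewrite (bigD1 k0) //= [RHS](bigD1 k0) //= -vE.
rewrite [X in _ + X = _](eq_bigr (fun k : 'I_t.+1 => phi (y' (m * t.+1%:Z + k%:Z)))).
  by move/addIr.
move=> k kk0; congr phi.
have -> : m * t.+1%:Z + k%:Z = v + (k%:Z - k0%:Z) by rewrite vE; lia.
apply: eqy; rewrite in_punctured_itv_sym.
have : (k : nat) <> k0 by move=> /val_inj ek; rewrite ek eqxx in kk0.
by have := ltn_ord k; have := ltn_ord k0; lia.
Qed.

(** * Lifting to the plane by rows or columns, and the lower bound on block counts *)

Lemma rows_recoverable (Q : finType) (l r b a t : nat) (Y : set (int -> Q)) :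
  (t <= l)%N -> (t <= r)%N -> recoverable_system (punctured_itv t t) Y ->
  recoverable_system (axial_product (punctured_itv l r) (punctured_itv b a))
    [set x : int * int -> Q | forall j, Y (word_row x j)].
Proof.
move=> tl tr /recoverable_systemP[[y Yy] recY]; apply/recoverable_systemP; split.
  by exists (fun z => y z.1).
move=> [i j] x x' Xx Xx' eqx.
apply: (recY i (word_row x j) (word_row x' j)) => // k kR.
have := eqx (k, 0); rewrite /word_row.
have -> : (i, j) + (k, 0) = (i + k, j) :> (int * int)%type by congr (_, _); exact: addr0.
apply; rewrite mem_axial_product /= eqxx andbT.
by move: kR; rewrite !in_punctured_itv; lia.
Qed.

Lemma columns_recoverable (Q : finType) (l r b a t : nat) (Y : set (int -> Q)) :
  (t <= b)%N -> (t <= a)%N -> recoverable_system (punctured_itv t t) Y ->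
  recoverable_system (axial_product (punctured_itv l r) (punctured_itv b a))
    [set x : int * int -> Q | forall i, Y (word_column x i)].
Proof.
move=> tb ta /recoverable_systemP[[y Yy] recY]; apply/recoverable_systemP; split.
  by exists (fun z => y z.2).
move=> [i j] x x' Xx Xx' eqx.
apply: (recY j (word_column x i) (word_column x' i)) => // k kR.
have := eqx (0, k); rewrite /word_column.
have -> : (i, j) + (0, k) = (i, j + k) :> (int * int)%type by congr (_, _); exact: addr0.
apply; rewrite mem_axial_product /=; apply/orP; right.
by move: kR; rewrite !in_punctured_itv; lia.
Qed.

(** Transposing a block carries the row count over to columns. *)
Lemma card_square_blocks_columns (Q : finType) (Y : set (int -> Q)) n :
  (#|square_blocks [set x | forall j, Y (word_row x j)] n| <=
   #|square_blocks [set x | forall i, Y (word_column x i)] n|)%N.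
Proof.
pose swap (p : 'I_n * 'I_n) := (p.2, p.1).
pose f (w : {ffun 'I_n * 'I_n -> Q}) := [ffun p => w (swap p)].
have f_inj : injective f.
  by move=> w w' /ffunP eqw; apply/ffunP => -[i j]; have := eqw (j, i); rewrite !ffunE.
rewrite -(card_imset _ f_inj); apply: subset_leq_card.
apply/fintype.subsetP => _ /imsetP[w /square_blocksP[x Xx wx] ->].
apply/square_blocksP; exists (fun z => x (z.2, z.1)) => [i|p]; first exact: Xx.
by rewrite ffunE wx.
Qed.

(** Position [i] ends a block when [t.+1] divides [i.+1]; what is counted are the free positions of
    a row of the square. *)
Lemma count_dvdnS (t n : nat) :
  #|[pred i : 'I_n | ~~ (t.+1 %| i.+1)%N]| = (n - n %/ t.+1)%N.
Proof.
have := cardC [pred i : 'I_n | (t.+1 %| i.+1)%N]; rewrite card_ord => En.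
rewrite -{1}[n in RHS]En; suff -> : #|[pred i : 'I_n | (t.+1 %| i.+1)%N]| = (n %/ t.+1)%N.
  by rewrite addKn; apply: eq_card => i; rewrite !inE.
rewrite -sum1_card big_mkcond; elim: n {En} => [|n IH].
  by rewrite big_ord0 div0n.
by rewrite big_ord_recr /= IH divnS // addnC inE /=; case: ifP.
Qed.

(** Letters at positions that do not end a block can be prescribed at will, so restricting blocks to
    these positions is onto. *)
Lemma card_square_blocks_rows (Q : finType) (V : zmodType) (phi : Q -> V)
    (psi : V -> Q) (t n : nat) : cancel psi phi ->
  (#|Q| ^ (n * (n - n %/ t.+1)) <=
   #|square_blocks [set x | forall j, block_sum_zero phi t (word_row x j)] n|)%N.
Proof.
move=> psiK; pose G := {p : 'I_n * 'I_n | ~~ (t.+1 %| p.1.+1)%N}.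
have <- : #|{: G}| = (n * (n - n %/ t.+1))%N.
  rewrite card_sig mulnC -count_dvdnS -[X in (_ * X)%N]card_ord -cardX.
  by apply/eq_card => p; rewrite !inE andbT.
rewrite -card_ffun -cardsT.
pose restr (w : {ffun 'I_n * 'I_n -> Q}) := [ffun p : G => w (val p)].
apply: leq_trans (leq_imset_card restr _); apply: subset_leq_card.
apply/fintype.subsetP => g _; apply/imsetP.
(* Extends [g] to the plane by the filler letter [psi 0]. *)
pose x0 z := odflt (psi 0) (omap g [pick p : G | grid (val p) == z]).
have x0E (p : G) : x0 (grid (val p)) = g p.
  rewrite /x0; case: pickP => [p' /eqP eqp|/(_ p)]; last by rewrite eqxx.
  rewrite /=; congr (g _); apply/val_inj; move: eqp.
  by case: (val p) => ? ?; case: (val p') => ? ? [/val_inj-> /val_inj->].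
(* Rows carry separate constraints, so each is completed on its own. *)
have /choice[c cP] : forall j : int, exists y, block_sum_zero phi t y /\
    forall i : int, ~~ (t.+1%:Z %| i + 1)%Z -> y i = x0 (i, j).
  by move=> j; have [y] := block_sum_zero_completion t (word_row x0 j) psiK; exists y.
pose x (z : int * int) := c z.2 z.1.
exists [ffun p => x (grid p)].
  apply/square_blocksP; exists x => [j|p]; first exact: (cP j).1.
  by rewrite ffunE.
apply/ffunP => p; rewrite !ffunE /x -x0E; apply: esym.
apply: ((cP (grid (val p)).2).2 (grid (val p)).1).
by rewrite dvdzE /=; have := valP p; rewrite /= addn1.
Qed.

Theorem theorem5p4 (K : realType) (Q : finType) (hQ : (2 <= #|Q|)%N)
    (l r b a : nat)
    (hl : (0 < l)%N) (hr : (0 < r)%N) (hb : (0 < b)%N) (ha : (0 < a)%N) :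
  let R2 := axial_product (punctured_itv l r) (punctured_itv b a) in
  let t := maxn (minn l r) (minn a b) in
  let c : K := t%:R / (t%:R + 1) in
  capacity K Q R2 = c%:E /\
  exists Y : set (int -> Q),
    [/\ recoverable_system (punctured_itv t t) Y,
        t = minn l r ->
          let X := [set x : int * int -> Q | forall j, Y (word_row x j)] in
          recoverable_system R2 X /\ rate K X = c%:E
      & t = minn a b ->
          let X := [set x : int * int -> Q | forall i, Y (word_column x i)] in
          recoverable_system R2 X /\ rate K X = c%:E].
Proof.
move=> R2 t c.
have rate_ub (X : set (int * int -> Q)) : recoverable_system R2 X -> (rate K X <= c%:E)%E.
  move=> recX; have [X0 _] := recX; apply: rate_le => // n.
  exact: card_square_blocks_le (ltnW hQ) recX.
(* In this form the ordinals below the size of [Q] carry the additive group of integers modulo that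
   size. *)
have [q' qE] : exists q', #|Q| = q'.+2.
  by exists (#|Q| - 2)%N; rewrite -addn2 subnK.
pose phi (c : Q) : 'I_q'.+2 := cast_ord qE (enum_rank c).
pose psi (i : 'I_q'.+2) : Q := enum_val (cast_ord (esym qE) i).
have psiK : cancel psi phi by move=> i; rewrite /phi /psi enum_valK cast_ordKV.
have phiK : cancel phi psi by move=> i; rewrite /phi /psi cast_ordK enum_rankK.
pose Y := block_sum_zero phi t.
have recY : recoverable_system (punctured_itv t t) Y.
  exact: block_sum_zero_recoverable psiK (can_inj phiK).
have rows : t = minn l r ->
    let X := [set x : int * int -> Q | forall j, Y (word_row x j)] in
    recoverable_system R2 X /\ rate K X = c%:E.
  move=> tE X; have recX : recoverable_system R2 X.
    by apply: rows_recoverable recY; rewrite tE ?geq_minl ?geq_minr.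
  split=> //; apply/eqP; rewrite eq_le rate_ub //=.
  by apply: le_rate => // n; exact: card_square_blocks_rows psiK.
have columns : t = minn a b ->
    let X := [set x : int * int -> Q | forall i, Y (word_column x i)] in
    recoverable_system R2 X /\ rate K X = c%:E.
  move=> tE X; have recX : recoverable_system R2 X.
    by apply: columns_recoverable recY; rewrite tE ?geq_minl ?geq_minr.
  split=> //; apply/eqP; rewrite eq_le rate_ub //=.
  apply: le_rate => // n; apply: leq_trans (card_square_blocks_columns Y n).
  exact: card_square_blocks_rows psiK.
split; last by exists Y.
apply/eqP; rewrite eq_le; apply/andP; split.
  by apply: ge_ereal_sup => _ [X /rate_ub leX <-].
have [/rows|/columns] : t = minn l r \/ t = minn a b.
- by rewrite /t; lia.
- by move=> [/rate_le_capacity + <-]; apply.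
- by move=> [/rate_le_capacity + <-]; apply.
Qed.
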